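(* Let $P$ be a minuscule poset, arising from a minuscule representation of a complex simple Lie algebra with Weyl group $W$ and set of Coxeter generators $S=\{s_1,\ldots,s_n\}$, and labeled by elements of $S$ via the minuscule heap. Let $(s_{i_1},\ldots,s_{i_n})$ be any ordering of $S$, let $c=s_{i_1}s_{i_2}\cdots s_{i_n}$ be the corresponding Coxeter element, acting on $W^J$ by left translation of cosets, and let $\phi:J(P)\to W^J$ be the heap isomorphism. Then the diagram $$ \begin{array}{rcl} J(P) &\overset{\phi}{\longrightarrow}& W^J\\ t_{(i_1,\ldots,i_n)}\downarrow& &c\downarrow \\ J(P) &\overset{\phi}{\longrightarrow}& W^J \end{array} $$ is commutative; that is, $\phi(t_{(i_1,\ldots,i_n)}(I))=c\cdot\phi(I)$ for all $I\in J(P)$.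
   Context: Posets and toggles: for a finite poset $P$, $J(P)$ is the set of order ideals (down-closed subsets). For $p\in P$, the toggle $t_p:J(P)\to J(P)$ sends $I$ to the symmetric difference $I\,\Delta\,\{p\}$ if this is an order ideal, and to $I$ otherwise. Minuscule posets: let $\mathfrak{g}$ be a complex simple Lie algebra with a fixed Cartan subalgebra, simple roots $\alpha_1,\ldots,\alpha_n$, simple reflections $S=\{s_1,\ldots,s_n\}$, Weyl group $W=\langle S\rangle$ with length function $l$, and weight lattice $\Lambda$. The root order on $\Lambda$ is the transitive closure of the relations $\mu<\omega$ whenever $\omega-\mu$ is a simple root. A nontrivial irreducible finite-dimensional representation $V$ is minuscule if $W$ acts transitively on its set $\Lambda_V$ of weights; its highest weight $\lambda$ is its minuscule weight. The weight poset $Q_V$ is the restriction of the root order to $\Lambda_V$ (a distributive lattice when $V$ is minuscule), and the minuscule poset $P_V$ is the poset of join-irreducible elements of $Q_V$, so $J(P_V)\cong Q_V$. A minuscule poset is one of the form $P_V$. Parabolic quotient: let $V$ be a minuscule representation of $\mathfrak{g}$ with minuscule weight (highest weight) $\lambda$ and minuscule poset $P=P_V$, and let $J=\{i: s_i\lambda=\lambda\}$, $W_J=\langle s_i\rangle_{i\in J}$ (the stabilizer of $\lambda$), and let $W^J\subseteq W$ be the set of minimum-length representatives of the cosets in $W/W_J$; let $w_0^J$ be the longest element of $W^J$. The group $W$ acts on $W/W_J$ by left translation, $u(wW_J)=uwW_J$, hence on $W^J$ through the bijection $W^J\cong W/W_J$; so $u\cdot w$ is the minimum-length representative of $uwW_J$.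 Heap labeling: the element $w_0^J$ is fully commutative, i.e. all its reduced words are related by exchanges of adjacent commuting generators. Given a reduced word $s_{a_1}s_{a_2}\cdots s_{a_\ell}$ for $w_0^J$, the minuscule heap $P_{w_0^J}$ is the set $\{1,\ldots,\ell\}$ partially ordered by the transitive closure of the relations $j>j'$ for all integers $j<j'$ such that $s_{a_j}$ and $s_{a_{j'}}$ do not commute; the element $j$ is labeled by $s_{a_j}$. Up to label-preserving isomorphism it does not depend on the reduced word. As posets, $P_{w_0^J}\cong P_V$, and each element of $P=P_V$ is labeled by the label of the corresponding element of $P_{w_0^J}$. The map $\phi$: for $I\in J(P)$, choose a linear extension $(x_1,\ldots,x_t)$ of the partial order restricted to $I$ (smaller elements first), let $s_{b_r}$ be the label of $x_r$, and set $\phi(I)=s_{b_t}\cdots s_{b_2}s_{b_1}$. This is independent of the choice of linear extension and defines a bijection $J(P)\to W^J$ (an isomorphism of posets for the Bruhat order on $W^J$). Toggle sequence: for $1\le k\le n$, let $t'_k=\prod t_p$, the product over all $p\in P$ labeled by $s_k$ (these toggles commute). For an ordering $(s_{i_1},\ldots,s_{i_n})$ of $S$, set $t_{(i_1,\ldots,i_n)}=t'_{i_1}t'_{i_2}\cdots t'_{i_n}$, composed right to left (first toggle at all elements labeled $s_{i_n}$, and so on, finally at all elements labeled $s_{i_1}$). *)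

(* Defs.v *)
From HB Require Import structures.
From Stdlib Require Import Relation_Operators.
From mathcomp Require Import all_boot all_order all_algebra.
From mathcomp Require Import reals.
From mathcomp Require Import complex.

Set Implicit Arguments.
Unset Strict Implicit.
Unset Printing Implicit Defensive.

Import Order.TTheory GRing.Theory Num.Theory.
Local Open Scope ring_scope.

Section LieAlgebra.
Variables (F : fieldType) (g : vectType F) (br : g -> g -> g).

Definition lie_bracket : Prop :=
  [/\ forall x, linear (br x),
      forall y, linear (br^~ y),
      forall x, br x x = 0 &
      forall x y z, br x (br y z) + br y (br z x) + br z (br x y) = 0].

Definition lie_ideal (U : {vspace g}) : Prop :=
  forall x y, y \in U -> br x y \in U.

Definition lie_simple : Prop :=
  (exists x y, br x y != 0) /\
  (forall U : {vspace g}, lie_ideal U -> U = 0%VS \/ U = fullv).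

(* A Cartan subalgebra is a nilpotent self-normalizing subalgebra. Nilpotency:
   the iterated brackets [x_1, [x_2, ... [x_m, y]]] in h vanish for some m. *)
Definition cartan_subalgebra (h : {vspace g}) : Prop :=
  [/\ forall x y, x \in h -> y \in h -> br x y \in h,
      exists m, forall (xs : m.-tuple g) y,
        {subset xs <= h} -> y \in h -> foldr br y xs = 0 &
      forall x, (forall y, y \in h -> br x y \in h) -> x \in h].

Section Representation.
Variables (V : vectType F) (rho : {linear g -> 'End(V)}).

Definition lie_representation : Prop :=
  forall x y v, rho (br x y) v = rho x (rho y v) - rho y (rho x v).

Definition lie_irreducible : Prop :=
  (exists v : V, v != 0) /\
  (forall U : {vspace V}, (forall x v, v \in U -> rho x v \in U) ->
     U = 0%VS \/ U = fullv).

Definition lie_nontrivial : Prop := exists x v, rho x v != 0.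
End Representation.

Section Weights.
Variable h : {vspace g}.

Definition dual : vectType F := 'Hom(subvs_of h, F^o).

Definition weight_vector (M : vectType F) (act : g -> M -> M)
    (mu : dual) (v : M) : Prop :=
  forall t : subvs_of h, act (vsval t) v = (mu t : F) *: v.

Definition weight (M : vectType F) (act : g -> M -> M) (mu : dual) : Prop :=
  exists2 v : M, v != 0 & weight_vector act mu v.

Definition is_root (a : dual) : Prop := a != 0 /\ weight br a.

Definition simple_system n (alpha : 'I_n -> dual) : Prop :=
  [/\ forall i, is_root (alpha i),
      free [tuple alpha i | i < n] &
      forall b, is_root b -> exists m : 'I_n -> nat,
        b = \sum_i alpha i *+ m i \/ b = - \sum_i alpha i *+ m i].

(* The coroot of a is the element of [g_a, g_(-a)] on which a takes the value
   2; root spaces are lines, so that every element of [g_a, g_(-a)] is a single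
   bracket. *)
Definition is_coroot (a : dual) (t : subvs_of h) : Prop :=
  a t = 2 /\
  exists e f, [/\ weight_vector br a e, weight_vector br (- a) f &
                  vsval t = br e f].

Section Reflection.
Variables (a : dual) (t : subvs_of h).

Definition reflection_fun (mu : dual) : dual := mu - (mu t : F) *: a.

Fact reflection_fun_is_linear : linear reflection_fun.
Proof.
move=> k u v; rewrite /reflection_fun add_lfunE scale_lfunE scalerDl scalerBr.
by rewrite scalerA addrACA opprD.
Qed.

HB.instance Definition _ :=
  GRing.isLinear.Build F dual dual *:%R reflection_fun reflection_fun_is_linear.

Definition reflection : 'End(dual) := linfun reflection_fun.
End Reflection.

Section RootOrder.
Variables (n : nat) (alpha : 'I_n -> dual) (coroot : 'I_n -> subvs_of h).

Definition weight_lattice (mu : dual) : Prop :=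
  forall i, exists m : int, mu (coroot i) = m%:~R.

Definition root_step (mu om : dual) : Prop :=
  [/\ weight_lattice mu, weight_lattice om & exists i, om - mu = alpha i].

Definition root_le : dual -> dual -> Prop := clos_refl_trans dual root_step.
End RootOrder.
End Weights.
End LieAlgebra.

Section JoinIrreducible.
Variables (T : Type) (Q : T -> Prop) (le : T -> T -> Prop).

Definition is_join (x y z : T) : Prop :=
  [/\ Q z, le x z, le y z & forall u, Q u -> le x u -> le y u -> le z u].

Definition join_irreducible (z : T) : Prop :=
  [/\ Q z, exists2 u, Q u & ~ le z u &
      forall x y, Q x -> Q y -> is_join x y z -> z = x \/ z = y].

(* P is isomorphic to the poset of join-irreducible elements of (Q, le). *)
Definition join_irreducible_poset d (P : finPOrderType d) : Prop :=
  exists e : P -> T,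
    (forall p q, (p <= q)%O <-> le (e p) (e q)) /\
    (forall z, join_irreducible z <-> exists p, e p = z).
End JoinIrreducible.

Section WeylGroup.
Variables (F : fieldType) (E : vectType F) (n : nat) (s : 'I_n -> 'End(E)).

(* The word [:: a_1; ...; a_l] stands for s_{a_1} ... s_{a_l}, composed from
   right to left. *)
Definition word_prod (a : seq 'I_n) : 'End(E) :=
  foldr (fun i w => (s i \o w)%VF) \1%VF a.

Definition weyl (w : 'End(E)) : Prop := exists a, word_prod a = w.

Definition has_length (w : 'End(E)) (k : nat) : Prop :=
  (exists2 a, size a = k & word_prod a = w) /\
  (forall a, word_prod a = w -> (k <= size a)%N).

Definition reduced_word (a : seq 'I_n) (w : 'End(E)) : Prop :=
  word_prod a = w /\ has_length w (size a).

Variable lambda : E.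

Definition parabolic (x : 'End(E)) : Prop :=
  exists2 a, all (fun i => s i lambda == lambda) a & word_prod a = x.

Definition same_coset (w w' : 'End(E)) : Prop :=
  exists2 x, parabolic x & w' = (w \o x)%VF.

Definition min_rep (w : 'End(E)) : Prop :=
  weyl w /\
  (forall w' k k', same_coset w w' -> has_length w k -> has_length w' k' ->
     (k <= k')%N).

Definition longest_min_rep (w : 'End(E)) : Prop :=
  min_rep w /\
  (forall v k k', min_rep v -> has_length v k -> has_length w k' ->
     (k <= k')%N).

(* v = u . w for the action of W on W^J *)
Definition left_translate (u w v : 'End(E)) : Prop :=
  min_rep v /\ same_coset (u \o w)%VF v.

(* i precedes j in the heap when the position i is to the right of j in the
   word and the two letters do not commute. *)
Definition heap_step (a : seq 'I_n) : rel 'I_(size a) :=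
  fun i j => (j < i)%N &&
    let si := s (tnth (in_tuple a) i) in let sj := s (tnth (in_tuple a) j) in
    (si \o sj)%VF != (sj \o si)%VF.

Definition heap_le (a : seq 'I_n) : rel 'I_(size a) := connect (heap_step (a := a)).

Definition heap_labeling (w : 'End(E)) d (P : finPOrderType d)
    (lab : P -> 'I_n) : Prop :=
  exists a : seq 'I_n, reduced_word a w /\
  exists f : P -> 'I_(size a),
    [/\ bijective f,
        forall p q, (p <= q)%O = heap_le (f p) (f q) &
        forall p, lab p = tnth (in_tuple a) (f p)].
End WeylGroup.

Section Toggles.
Variables (d : Order.disp_t) (P : finPOrderType d).

Definition order_ideal (I : {set P}) : bool :=
  [forall p in I, forall q, (q <= p)%O ==> (q \in I)].

Definition toggle (p : P) (I : {set P}) : {set P} :=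
  let I' := (I :\: [set p]) :|: ([set p] :\: I) in
  if order_ideal I' then I' else I.

Variables (n : nat) (lab : P -> 'I_n).

Definition toggle_label (k : 'I_n) (I : {set P}) : {set P} :=
  foldr toggle I (enum [pred p | lab p == k]).

Definition toggle_word (ks : seq 'I_n) (I : {set P}) : {set P} :=
  foldr toggle_label I ks.

Definition linear_extension (I : {set P}) (xs : seq P) : Prop :=
  [/\ uniq xs, xs =i I &
      {in I &, forall x y, (x <= y)%O -> (index x xs <= index y xs)%N}].

(* phi assigns to every order ideal I the product s_{b_t} ... s_{b_1} of the
   labels along some linear extension of I. *)
Definition heap_map (F : fieldType) (E : vectType F) (s : 'I_n -> 'End(E))
    (phi : {set P} -> 'End(E)) : Prop :=
  forall I, order_ideal I -> exists2 xs, linear_extension I xs &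
    phi I = word_prod s (rev [seq lab x | x <- xs]).
End Toggles.

(* Main.v *)
Require Import Defs.
From HB Require Import structures.
From mathcomp Require Import all_boot all_order all_algebra.
From mathcomp Require Import zify ring.
From mathcomp Require Import reals.
From mathcomp Require Import complex.

Set Implicit Arguments.
Unset Strict Implicit.
Unset Printing Implicit Defensive.

Import Order.TTheory GRing.Theory Num.Theory.
Import VectorInternalTheory.
Local Open Scope ring_scope.

(** The theorem reduces to one generator at a time: toggling all points of label
    [k] should correspond to multiplying by [s_k] on the left, up to the
    stabilizer of the highest weight [lambda] on the right. The bridge is the
    weight [phi I lambda] of an ideal [I], which is [lambda] minus the simple
    roots labelling the points of [I].

    In a minuscule representation every weight takes only the values [-1], [0],
    [1] on a simple coroot ([LambdaV_pairing]). If the weight of [I] takes the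
    value [1] on the [k]-th coroot, exactly one point of label [k] can be added to
    [I]; if it takes the value [-1], exactly one can be removed; if it takes the
    value [0], none can be added or removed ([flip_weight], [flip_unique],
    [flip_exists_add], [flip_exists_del]). On the other side [s_k] subtracts the
    simple root, adds it, or fixes the weight. So both sides move to the same
    weight, and it remains to compare group elements.

    This comparison does not go through the general theory of Coxeter groups.
    Call a word descending if each of its letters, read from right to left,
    lowers the weight by one simple root. The bounds on pairings imply that two
    descending words that reach the same weight have the same product
    ([descending_unique]), that a generator fixing the weight of a descending word
    is absorbed by the stabilizer ([fixed_letter], where only the rank two braid
    relations of types A1 x A1, A2 and B2 occur), and therefore that every word is
    a descending word, no longer than itself, times an element of the stabilizer
    ([word_descend]). Hence the minimal coset representatives are precisely the
    products of descending words, and there is one in each coset.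

    The reduced word of the longest representative is thus descending, and this
    gives the heap its properties: points with equal or adjacent labels are
    comparable ([cartan_heap_le]), a point that can be added to an ideal sees the
    value [1] ([addable_weight_heap]), and linear extensions of ideals spell
    descending words ([linear_extension_descending]).

    The input from Lie theory is the reflection of weights in a string of an
    [sl2]-triple ([weight_reflection]), applied to the adjoint action for the
    signs of the Cartan integers and to the representation for the bounds on
    pairings; the latter follow since the highest weight is an extreme point and
    the Weyl group is transitive on weights. *)

(** * Descending words in a minuscule orbit *)

Section MinusculeWords.
Variables (F : numFieldType) (E : vectType F) (n : nat).
Variables (root : 'I_n -> E) (pairing : 'I_n -> E -> F).
Variables (cartan : 'I_n -> 'I_n -> int).
Variables (s : 'I_n -> 'End(E)) (lambda : E) (fundamental : 'I_n -> int).

(** The geometry that the combinatorics of a minuscule orbit needs: [cartan i j]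
    is the value of the [i]-th coroot on the [j]-th simple root and
    [fundamental i] its value on the highest weight. The condition
    [orbit_pairing] is minusculity: it bounds all weights in the orbit of
    [lambda]. *)
Record minuscule_weight : Prop := MinusculeWeight {
  pairing_lin : forall i u c v,
    pairing i (u + c *: v) = pairing i u + c * pairing i v;
  pairing_root : forall i j, pairing i (root j) = (cartan i j)%:~R;
  pairing_lambda : forall i, pairing i lambda = (fundamental i)%:~R;
  reflE : forall i mu, s i mu = mu - pairing i mu *: root i;
  root_free : forall i j a b, i != j -> a *: root i = b *: root j -> a = 0;
  cartan_diag : forall i, cartan i i = 2;
  cartan_le0 : forall i j, i != j -> cartan i j <= 0;
  cartan_eq0 : forall i j, cartan i j = 0 -> cartan j i = 0;
  fundamental_ge0 : forall i, 0 <= fundamental i;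
  orbit_pairing : forall i a, exists2 z : int, -1 <= z <= 1 &
    pairing i (word_prod s a lambda) = z%:~R }.

(** For a word [b] that descends from [lambda] one simple root per letter,
    this is the pairing of the weight [word_prod s b lambda] with coroot [i]
    (lemma [letter_weightE]); it is additive in the letters for every word. *)
Definition letter_weight (b : seq 'I_n) (i : 'I_n) : int :=
  fundamental i - \sum_(j <- b) cartan i j.

(** Read from right to left, each letter lowers the current weight by exactly
    one simple root. These words play the role of the reduced words of the
    minimal coset representatives. *)
Fixpoint descending (b : seq 'I_n) : bool :=
  if b is i :: b' then (letter_weight b' i == 1) && descending b' else true.

Hypothesis mw : minuscule_weight.

Local Notation word := (word_prod s).
Local Notation wt := letter_weight.

Lemma letter_weight_cons i b j : wt (i :: b) j = wt b j - cartan j i.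
Proof. by rewrite /letter_weight big_cons; ring. Qed.

Lemma letter_weight_perm b b' : perm_eq b b' -> wt b =1 wt b'.
Proof. by move=> bb' i; rewrite /letter_weight (perm_big _ bb'). Qed.

Lemma word_cat a b : word (a ++ b) = (word a \o word b)%VF.
Proof.
by elim: a => [|i a IH] /=; rewrite ?comp_lfun1l // IH comp_lfunA.
Qed.

(** The two reflections [s i] and [s j] move [mu] inside the plane through [mu]
    spanned by two roots; tracking the two coordinates turns the braid relations
    into polynomial identities. *)
Definition rank2 i j mu (ab : F * F) : E :=
  mu + (ab.1 *: root i + ab.2 *: root j).

Lemma rank2_0 i j mu : rank2 i j mu (0, 0) = mu.
Proof. by rewrite /rank2 /= !scale0r !addr0. Qed.

Lemma refl_rank2l i j mu ab : s i (rank2 i j mu ab) =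
  rank2 i j mu (- pairing i mu - ab.1 - (cartan i j)%:~R * ab.2, ab.2).
Proof.
rewrite /rank2 (reflE mw) addrA !(pairing_lin mw) !(pairing_root mw).
rewrite (cartan_diag mw) -!addrA; congr (_ + _).
rewrite -scaleNr addrCA -scalerDl addrC; congr (_ *: _ + _).
by rewrite /=; ring.
Qed.

Lemma refl_rank2r i j mu ab : s j (rank2 i j mu ab) =
  rank2 i j mu (ab.1, - pairing j mu - ab.2 - (cartan j i)%:~R * ab.1).
Proof.
have rank2C u v (xy : F * F) : rank2 u v mu xy = rank2 v u mu (xy.2, xy.1).
  by rewrite /rank2 /= [_ *: _ + _]addrC.
by rewrite rank2C refl_rank2l rank2C.
Qed.

Lemma refl_involutive i : (s i \o s i)%VF = \1%VF.
Proof.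
apply/lfunP => mu; rewrite comp_lfunE id_lfunE -[mu](rank2_0 i i).
rewrite !refl_rank2l /= !mulr0 !subr0; congr rank2; congr (_, _); ring.
Qed.

Lemma reflK i (w : 'End(E)) : (s i \o (s i \o w))%VF = w :> 'End(E).
Proof. by rewrite comp_lfunA refl_involutive comp_lfun1l. Qed.

Lemma refl_commute i j : cartan i j = 0 -> (s i \o s j)%VF = (s j \o s i)%VF.
Proof.
move=> Aij; have Aji := cartan_eq0 mw Aij.
apply/lfunP => mu; rewrite !comp_lfunE -(rank2_0 i j mu).
rewrite !(refl_rank2l, refl_rank2r) /= Aij Aji.
by congr (rank2 _ _ _ (_, _)); ring.
Qed.

Lemma refl_braid3 i j : cartan i j = -1 -> cartan j i = -1 ->
  (s i \o (s j \o s i))%VF = (s j \o (s i \o s j))%VF.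
Proof.
move=> Aij Aji; apply/lfunP => mu; rewrite !comp_lfunE -(rank2_0 i j mu).
rewrite !(refl_rank2l, refl_rank2r) /= Aij Aji.
by congr (rank2 _ _ _ (_, _)); rewrite !rmorphN1; ring.
Qed.

Lemma refl_braid4 i j : cartan i j = -1 -> cartan j i = -2 ->
  (s i \o (s j \o (s i \o s j)))%VF = (s j \o (s i \o (s j \o s i)))%VF.
Proof.
move=> Aij Aji; apply/lfunP => mu; rewrite !comp_lfunE -(rank2_0 i j mu).
rewrite !(refl_rank2l, refl_rank2r) /= Aij Aji.
by congr (rank2 _ _ _ (_, _)); ring.
Qed.

(** Comparing both products on [root j], the coefficients of [root i] differ by
    twice [cartan i j]. *)
Lemma commute_cartan_eq0 i j :
  i != j -> (s i \o s j)%VF = (s j \o s i)%VF -> cartan i j = 0.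
Proof.
move=> ij /lfunP/(_ (root j)); rewrite !comp_lfunE.
rewrite -[X in s i (s j X)](rank2_0 i j) -[X in _ = s j (s i X)](rank2_0 i j).
rewrite !(refl_rank2l, refl_rank2r) /= /rank2 => /addrI /=.
rewrite !(pairing_root mw) (cartan_diag mw).
set c := (cartan i j)%:~R; set d := (cartan j i)%:~R => /eqP.
rewrite -subr_eq0 [- (_ *: _ + _)]opprD addrACA -!scalerBl => e.
have /(root_free mw ij)/eqP : (c *+ 2) *: root i = (d * c) *: root j.
  apply/eqP; rewrite -subr_eq0 -scaleNr; apply: etrans e.
  by congr (_ *: _ + _ *: _ == 0); ring.
by rewrite mulrn_eq0 /= /c intr_eq0 => /eqP.
Qed.

Lemma letter_weightE b : descending b ->
  forall i, pairing i (word b lambda) = (wt b i)%:~R.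
Proof.
elim: b => [|j b IH] /=.
  move=> _ i; rewrite id_lfunE (pairing_lambda mw) /letter_weight big_nil.
  by rewrite subr0.
move=> /andP[/eqP wtj /IH wtE] i.
have esb : word (j :: b) lambda = word b lambda - root j.
  by rewrite /= comp_lfunE (reflE mw) wtE wtj scale1r.
rewrite [X in pairing i X]esb -scaleN1r (pairing_lin mw) wtE (pairing_root mw).
by rewrite letter_weight_cons; ring.
Qed.

Lemma letter_weight_bound b i : descending b -> -1 <= wt b i <= 1.
Proof.
move=> /letter_weightE wtE; have [z zb] := orbit_pairing mw i b.
by rewrite wtE => /intr_inj ->.
Qed.

(** Every descending word can be rewritten, by commutations only, to begin
    with any letter that raises its weight. If [j] is the first letter and
    [j != i], the weight before applying [j] pairs with coroot [i] to
    [-1 + cartan i j]; this is at least [-1] while [cartan i j <= 0], so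
    [cartan i j] vanishes and [j] can be moved past [i]. This is the reason why
    minimal representatives are fully commutative. *)
Lemma ascend b i : descending b -> wt b i = -1 ->
  exists b2, [/\ descending b2, perm_eq b (i :: b2) &
                 word b = (s i \o word b2)%VF].
Proof.
elim: b => [|j b IH] /=.
  move=> _ wti; have := fundamental_ge0 mw i.
  by move: wti; rewrite /letter_weight big_nil; lia.
move=> /andP[/eqP wtj db] wti; have [->|ij] := eqVneq i j.
  by exists b.
have := letter_weight_bound i db; have := cartan_le0 mw ij.
move: wti; rewrite letter_weight_cons => wti le0 bd.
have Aij : cartan i j = 0 by lia.
have [|b2 [db2 pb2 eb2]] := IH db; first by lia.
exists (j :: b2); split.
- rewrite /= db2 andbT; apply/eqP.
  have := letter_weight_perm pb2 j; rewrite letter_weight_cons.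
  by rewrite (cartan_eq0 mw Aij); lia.
- rewrite (perm_trans (_ : perm_eq _ (j :: i :: b2))) ?perm_cons //.
  by rewrite -(cat1s j) -(cat1s i) perm_catCA.
- by rewrite eb2 /= !comp_lfunA (refl_commute Aij).
Qed.

Lemma descending_cons_wt i b : descending (i :: b) -> wt (i :: b) i = -1.
Proof.
by move=> /andP[/eqP w1 _]; rewrite letter_weight_cons w1 (cartan_diag mw).
Qed.

(** The first letter of [b] raises their common weight, hence by [ascend] it can
    be moved to the front of [b'] as well, and one cancels it on both sides. *)
Lemma descending_unique b b' : descending b -> descending b' ->
  wt b =1 wt b' -> word b = word b' /\ size b = size b'.
Proof.
elim: b b' => [|i b IH] b' db db' wtE.
  case: b' db' wtE => // j b' /descending_cons_wt wj /(_ j).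
  rewrite wj /letter_weight big_nil subr0 => f0.
  by have := fundamental_ge0 mw j; rewrite f0.
have [|b2 [db2 pb2 ->]] := @ascend b' i db'.
  by rewrite -wtE descending_cons_wt.
have := perm_size pb2 => /= ->.
case/andP: (db) => _ db1; have [] := IH b2 db1 db2; last by move=> /= -> ->.
move=> k; have := wtE k; rewrite (letter_weight_perm pb2) !letter_weight_cons.
by move=> /addIr.
Qed.

Local Notation parabolic := (parabolic s lambda).

Lemma parabolic1 : parabolic \1%VF.
Proof. by exists [::]. Qed.

Lemma parabolic_comp x y : parabolic x -> parabolic y -> parabolic (x \o y)%VF.
Proof.
move=> [a fa <-] [b fb <-]; exists (a ++ b); first by rewrite all_cat fa.
exact: word_cat.
Qed.

Lemma parabolic_inv x : parabolic x ->
  exists2 y, parabolic y & (x \o y)%VF = \1%VF.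
Proof.
move=> [a fa <-]; exists (word (rev a)); first by exists (rev a); rewrite ?all_rev.
elim: a {fa} => [|i a IH] /=; first by rewrite comp_lfun1l.
rewrite rev_cons -cats1 word_cat /= comp_lfun1r -comp_lfunA.
by rewrite [X in (_ \o X)%VF]comp_lfunA IH comp_lfun1l refl_involutive.
Qed.

Lemma parabolic_fix x : parabolic x -> x lambda = lambda.
Proof.
move=> [a fa <-]; elim: a fa => [|i a IH] /=; first by rewrite id_lfunE.
by move=> /andP[/eqP fi /IH fa]; rewrite comp_lfunE fa.
Qed.

(** A generator that fixes the weight of [b] is conjugated by [word b] into the
    stabilizer of [lambda]. Peeling off the first letters of [b] that interact
    with [i], the bound on pairings leaves only the types A1 x A1, A2 and B2 for
    the pair of letters involved. In each of them the braid relation turns the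
    claim into the same claim for a shorter descending word, whose weight one of
    the two generators fixes. *)
Lemma fixed_letter b i : descending b -> wt b i = 0 ->
  exists2 x, parabolic x & (s i \o word b)%VF = (word b \o x)%VF.
Proof.
have [m] := ubnP (size b); elim: m b i => // m IH [|j b1] i /=.
  move=> _ _; rewrite /letter_weight big_nil subr0 => wi.
  exists (s i); last by rewrite comp_lfun1l comp_lfun1r.
  exists [:: i]; rewrite /= ?comp_lfun1r // andbT (reflE mw).
  by rewrite (pairing_lambda mw) wi scale0r subr0.
rewrite ltnS => szb /andP[/eqP wj db1] wi.
have ij : i != j.
  by apply/eqP=> ij; move: wi; rewrite letter_weight_cons ij wj (cartan_diag mw).
move: wi; rewrite letter_weight_cons => wi.
have le0 := cartan_le0 mw ij; have := letter_weight_bound i db1.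
have le0' : cartan j i <= 0 by apply: (cartan_le0 mw); rewrite eq_sym.
have [Aij|Aij] := eqVneq (cartan i j) 0 => bd.
  have [|x px ex] := IH b1 i szb db1; first by lia.
  exists x => //; rewrite comp_lfunA (refl_commute Aij) -!comp_lfunA.
  by rewrite ex.
have {bd}Aij1 : cartan i j = -1 by lia.
(* The weight [-1] at [i] lets [i] be brought to the front of [b1]. *)
have Aji : cartan j i != 0.
  by apply: contra Aij => /eqP /(cartan_eq0 mw) ->.
have [|b2 [db2 pb2 eb2]] := ascend db1 (i := i); first by lia.
have szb2 := perm_size pb2; have wt2 k := letter_weight_perm pb2 k.
move: (wt2 i) (wt2 j); rewrite !letter_weight_cons (cartan_diag mw) => wt2i wt2j.
have := letter_weight_bound j db2 => bd.
have [Aji1|Aji1] := eqVneq (cartan j i) (-1).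
  have [|||x px ex] := IH b2 j; [by rewrite /= in szb2; lia|by []|by lia|].
  exists x => //; rewrite eb2 -!comp_lfunA -ex.
  have := congr1 (fun f => (f \o word b2)%VF) (refl_braid3 Aij1 Aji1).
  by rewrite -!comp_lfunA.
(* In type B2 the weight of [b2] at [j] is [-1], so [j] can be extracted too. *)
have Aji2 : cartan j i = -2 by lia.
have [|b3 [db3 pb3 eb3]] := ascend db2 (i := j); first by lia.
have szb3 := perm_size pb3; have := letter_weight_perm pb3 i.
rewrite letter_weight_cons => wt3i.
have [|||x px ex] := IH b3 i; [by rewrite /= in szb2 szb3; lia|by []|by lia|].
exists x => //; rewrite eb2 eb3 -!comp_lfunA -ex.
have := congr1 (fun f => (f \o word b3)%VF) (refl_braid4 Aij1 Aji2).
by rewrite -!comp_lfunA.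
Qed.

(** Applying the letters of [c] one at a time, a letter extends the descending
    word, is absorbed by the stabilizer on the right ([fixed_letter]), or
    cancels ([ascend]). Only the first possibility increases the length, so the
    lengths agree exactly when every letter of [c] is of this kind. *)
Lemma word_descend c : exists b, [/\ descending b, (size b <= size c)%N,
  exists2 x, parabolic x & word c = (word b \o x)%VF &
  size b = size c -> descending c].
Proof.
elim: c => [|i c [b1 [db1 szb1 [x px ex] dc]]] /=.
  by exists [::]; split=> //; exists \1%VF; [exact: parabolic1|rewrite comp_lfun1l].
have := letter_weight_bound i db1 => bd.
have [wi|wi] := eqVneq (wt b1 i) 1.
  exists (i :: b1); split=> //=; first by rewrite wi eqxx.
    by exists x => //; rewrite ex comp_lfunA.
  move=> [] /dc{}dc; rewrite dc andbT.
  have := letter_weightE dc i.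
  rewrite ex comp_lfunE (parabolic_fix px) (letter_weightE db1).
  by move=> /intr_inj <-; apply/eqP.
have [wi0|wi0] := eqVneq (wt b1 i) 0.
  exists b1; split=> //; [exact: leqW| |by move=> e; move: szb1; rewrite e ltnn].
  have [y py ey] := fixed_letter db1 wi0.
  exists (y \o x)%VF; first exact: parabolic_comp.
  by rewrite ex !comp_lfunA ey.
have [|b2 [db2 pb2 eb2]] := ascend db1 (i := i); first by lia.
have := perm_size pb2 => /= szb2.
exists b2; split=> //; [by lia| |by lia].
by exists x => //; rewrite ex eb2 -comp_lfunA reflK.
Qed.

Lemma descending_size_min b c : descending b ->
  word b lambda = word c lambda -> (size b <= size c)%N.
Proof.
move=> db e; have [b' [db' sz [x px ex] _]] := word_descend c.
have [|_ ->] := descending_unique db db'; last by [].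
move=> i; apply: (@intr_inj F).
rewrite -(letter_weightE db) -(letter_weightE db').
by rewrite e ex comp_lfunE (parabolic_fix px).
Qed.

End MinusculeWords.

(** * Order ideals and flips *)

Section Ideals.
Variables (d : Order.disp_t) (P : finPOrderType d).
Implicit Types (I : {set P}) (p q : P).

Lemma order_idealP I :
  reflect (forall p q, p \in I -> (q <= p)%O -> q \in I) (order_ideal I).
Proof.
apply: (iffP idP) => [/forall_inP idI p q pI qp|idI].
  by have /forallP/(_ q)/implyP := idI p pI; apply.
by apply/forall_inP => p pI; apply/forallP => q; apply/implyP; apply: idI pI.
Qed.

Definition addable I p := (p \notin I) && [forall q, (q < p)%O ==> (q \in I)].

Lemma addableP I p :
  reflect (p \notin I /\ forall q, (q < p)%O -> q \in I) (addable I p).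
Proof.
apply: (iffP andP) => -[pI h]; split=> //.
  by move=> q qp; move/forallP/(_ q)/implyP: h; apply.
by apply/forallP => q; apply/implyP; apply: h.
Qed.

Lemma addable_setD1 I p : order_ideal I -> p \in I -> addable (I :\ p) p.
Proof.
move=> /order_idealP idI pI; apply/addableP; rewrite !inE eqxx; split=> // q qp.
by rewrite !inE (lt_eqF qp) (idI p) // ltW.
Qed.

Lemma addable_ideal I p : order_ideal I -> p \notin I ->
  addable I p = order_ideal (p |: I).
Proof.
move=> /order_idealP idI pI; apply/addableP/order_idealP.
  move=> [_ h] x y; rewrite !inE => /orP[/eqP-> |xI yx].
    by rewrite le_eqVlt => /orP[-> //|/h ->]; rewrite orbT.
  by rewrite (idI x y xI yx) orbT.
move=> h; split=> // q qp; have := h p q; rewrite !inE eqxx (lt_eqF qp).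
by apply=> //; apply: ltW.
Qed.

(** The symmetric difference with a point, in the form used by [toggle]. *)
Definition flip I p := (I :\: [set p]) :|: ([set p] :\: I).

Lemma flip_notin I p : p \notin I -> flip I p = p |: I.
Proof.
move=> pI; apply/setP => q; rewrite !inE; have [->|_] /= := eqVneq q p.
  by rewrite pI.
by rewrite andbF orbF.
Qed.

Lemma flip_in I p : p \in I -> flip I p = I :\ p.
Proof.
move=> pI; apply/setP => q; rewrite !inE; have [->|_] /= := eqVneq q p.
  by rewrite pI.
by rewrite andbF orbF.
Qed.

Lemma flipK I p : flip (flip I p) p = I.
Proof.
apply/setP => q; rewrite !inE; have [->|_] /= := eqVneq q p.
  by case: (p \in I).
by rewrite !andbF !orbF.
Qed.

Lemma toggleE I p :
  toggle p I = if order_ideal (flip I p) then flip I p else I.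
Proof. by []. Qed.

Lemma toggle_ideal I p : order_ideal I -> order_ideal (toggle p I).
Proof. by move=> idI; rewrite toggleE; case: ifP. Qed.

End Ideals.

(** * Toggling all points of one label *)

Section ToggleLabel.
Variables (d : Order.disp_t) (P : finPOrderType d) (n : nat).
Variables (lab : P -> 'I_n) (cartan : 'I_n -> 'I_n -> int).
Variable fundamental : 'I_n -> int.
Implicit Types (I J : {set P}) (p q : P).

Definition ideal_weight I (k : 'I_n) : int :=
  fundamental k - \sum_(q in I) cartan k (lab q).

Local Notation wt := ideal_weight.

(** What the toggles see of a minuscule heap. The value [ideal_weight I k] is
    the pairing with coroot [k] of the weight that corresponds to the ideal [I].
    The last three conditions say that adding a point is a lowering step in the
    direction of its label, that the weights of ideals obey the bounds of a
    minuscule orbit, and that the full poset gives the lowest weight. *)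
Record minuscule_poset : Prop := MinusculePoset {
  poset_cartan_diag : forall i, cartan i i = 2;
  poset_cartan_le0 : forall i j, i != j -> cartan i j <= 0;
  poset_cartan_eq0 : forall i j, cartan i j = 0 -> cartan j i = 0;
  poset_fundamental_ge0 : forall i, 0 <= fundamental i;
  comparable_label : forall p q, lab p = lab q -> (p <= q)%O || (q <= p)%O;
  neighbour_below : forall p q, (p < q)%O ->
    exists2 r, (p <= r < q)%O & cartan (lab r) (lab q) != 0;
  neighbour_above : forall p q, (p < q)%O ->
    exists2 r, (p < r <= q)%O & cartan (lab r) (lab p) != 0;
  addable_weight : forall I p, order_ideal I -> addable I p ->
    wt I (lab p) = 1;
  ideal_weight_bound : forall I k, order_ideal I -> -1 <= wt I k <= 1;
  ideal_weight_top : forall k, wt [set: P] k <= 0 }.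

Hypothesis mp : minuscule_poset.

Lemma ideal_weight_subset I J k : I \subset J ->
  wt J k = wt I k - \sum_(q in J :\: I) cartan k (lab q).
Proof.
by move=> /setIidPr IJ; rewrite /wt (big_setID I) /= IJ opprD addrA.
Qed.

Lemma ideal_weight_add I p k : p \notin I ->
  wt (p |: I) k = wt I k - cartan k (lab p).
Proof. by move=> pI; rewrite /wt big_setU1 //= opprD addrAC addrA. Qed.

Lemma ideal_weight_del I p k : p \in I ->
  wt (I :\ p) k = wt I k + cartan k (lab p).
Proof.
move=> pI; rewrite -[in RHS](setD1K pI) ideal_weight_add ?subrK //.
by rewrite !inE eqxx.
Qed.

(** A point of label [k] can be added only at weight [1], and after its addition
    the weight is [-1]: the weight tells additions from removals. *)
Lemma flip_weight I p : order_ideal I -> order_ideal (flip I p) ->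
  wt I (lab p) = if p \in I then -1 else 1.
Proof.
move=> idI; case: ifP => [pI|/negbT pI].
  rewrite (flip_in pI) => /(addable_weight mp).
  move=> /(_ _ (addable_setD1 idI pI)).
  by rewrite ideal_weight_del // (poset_cartan_diag mp); lia.
by rewrite (flip_notin pI) -addable_ideal //; apply: (addable_weight mp).
Qed.

(** By the weights, both points are added or both are removed; they are
    comparable, and an ideal cannot gain the larger or lose the smaller one of
    two comparable points alone. *)
Lemma flip_unique I p q : order_ideal I -> lab p = lab q ->
  order_ideal (flip I p) -> order_ideal (flip I q) -> p = q.
Proof.
move=> idI pq; wlog le_pq : p q pq / (p <= q)%O => [hw ip iq|ip iq].
  have [/hw|/hw h] := orP (comparable_label mp pq); first exact.
  by rewrite (h (esym pq)).
have := flip_weight idI iq; rewrite -pq (flip_weight idI ip).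
have [pI|pI] := boolP (p \in I); have [qI|qI] := boolP (q \in I) => // _.
  move: ip; rewrite flip_in // => /order_idealP/(_ q p); rewrite !inE eqxx qI.
  by rewrite andbT; apply: contraPeq => neq; rewrite eq_sym neq => /(_ isT le_pq).
move: iq; rewrite flip_notin // => /order_idealP/(_ q p); rewrite !inE eqxx.
by rewrite (negbTE pI) orbF => /(_ isT le_pq)/eqP.
Qed.

Lemma sum_cartan_le0 k (B : {set P}) : (forall q, q \in B -> lab q != k) ->
  \sum_(q in B) cartan k (lab q) <= 0.
Proof.
move=> Bk; apply: sumr_le0 => q qB; apply: (poset_cartan_le0 mp).
by rewrite eq_sym Bk.
Qed.

Lemma sum_cartan_eq0 k (B : {set P}) : (forall q, q \in B -> lab q != k) ->
  \sum_(q in B) cartan k (lab q) = 0 ->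
  forall q, q \in B -> cartan (lab q) k = 0.
Proof.
move=> Bk /eqP; rewrite -oppr_eq0 -sumrN => /eqP/psumr_eq0P h q qB.
apply: (poset_cartan_eq0 mp); apply/eqP; rewrite -oppr_eq0; apply/eqP/h => //.
by move=> r rB; rewrite oppr_ge0 (poset_cartan_le0 mp) // eq_sym Bk.
Qed.

(** Some point of label [k] lies outside [I], since otherwise the remaining
    points could only raise the weight, which ends at a value [<= 0]. Take a
    lowest such point [p] and add to [I] everything below [p]. The weight at [k]
    is again [1], and none of the added points has label [k], so none of them has
    a label adjacent to [k]. Were some point added, a neighbour of [p] below [p]
    would be among them, with a label adjacent to [k]. *)
Lemma flip_exists_add I k : order_ideal I -> wt I k = 1 ->
  exists2 p, lab p = k & order_ideal (flip I p).
Proof.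
move=> idI wI; have idIP := order_idealP _ idI.
have [p0 /andP[p0I /eqP p0k]] : exists p, (p \notin I) && (lab p == k).
  apply/existsP; apply: contraT => /existsPn noP.
  have := ideal_weight_top mp k; rewrite (ideal_weight_subset _ (subsetT I)) wI.
  have : \sum_(q in setT :\: I) cartan k (lab q) <= 0; last by lia.
  apply: sum_cartan_le0 => q; rewrite !inE andbT => qI.
  by have := noP q; rewrite qI.
pose out p := (p \notin I) && (lab p == k).
have out0 : out p0 by rewrite /out p0I p0k eqxx.
case: (arg_minnP (fun p => #|[set q | (q < p)%O]|) out0).
move=> p /andP[pI /eqP pk] pmin.
exists p => //; rewrite flip_notin // -addable_ideal //.
have low q : (q < p)%O -> q \notin I -> lab q != k.
  move=> qp qI; apply/negP => qk; have := pmin q; rewrite /out qI => /(_ qk).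
  rewrite leqNgt; apply/negP/negPn/proper_card/properP; split.
    by apply/subsetP => r; rewrite !inE => /lt_trans; apply.
  by exists q; rewrite !inE ?ltxx.
pose J := I :|: [set q | (q < p)%O].
have idJ : order_ideal J.
  apply/order_idealP => x y; rewrite !inE => /orP[xI|xp] yx.
    by rewrite (idIP x).
  by rewrite (le_lt_trans yx xp) orbT.
have addJ : addable J p.
  by apply/addableP; rewrite !inE ltxx orbF; split=> // q qp; rewrite !inE qp orbT.
have := addable_weight mp idJ addJ.
have IJ : I \subset J by apply: subsetUl.
rewrite pk (ideal_weight_subset _ IJ) wI => sum0.
have JI q : q \in J :\: I -> lab q != k.
  by rewrite !inE => /andP[qI]; rewrite (negbTE qI) /= => /low; apply.
have /(sum_cartan_eq0 JI){}sum0 : \sum_(q in J :\: I) cartan k (lab q) = 0 by lia.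
apply/addableP; split=> // q qp; apply: contraT => qI.
have [r /andP[qr rp]] := neighbour_below mp qp; rewrite pk => /eqP[].
apply: sum0.
by rewrite !inE rp orbT andbT; apply: contra qI => /idIP; apply.
Qed.

(** The mirror image of [flip_exists_add]: dominance of the highest weight gives
    a point of label [k] in [I], and one removes everything above a highest such
    point. *)
Lemma flip_exists_del I k : order_ideal I -> wt I k = -1 ->
  exists2 p, lab p = k & order_ideal (flip I p).
Proof.
move=> idI wI; have idIP := order_idealP _ idI.
pose inn p := (p \in I) && (lab p == k).
have [p0 in0] : exists p, inn p.
  apply/existsP; apply: contraT => /existsPn noP.
  have := poset_fundamental_ge0 mp k; move: wI; rewrite /wt.
  have : \sum_(q in I) cartan k (lab q) <= 0; last by lia.
  by apply: sum_cartan_le0 => q qI; have := noP q; rewrite /inn qI.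
case: (arg_minnP (fun p => #|[set q | (p < q)%O]|) in0).
move=> p /andP[pI /eqP pk] pmin.
exists p => //; rewrite flip_in //.
have high q : (p < q)%O -> q \in I -> lab q != k.
  move=> pq qI; apply/negP => qk; have := pmin q; rewrite /inn qI => /(_ qk).
  rewrite leqNgt; apply/negP/negPn/proper_card/properP; split.
    by apply/subsetP => r; rewrite !inE; apply: lt_trans.
  by exists q; rewrite !inE ?ltxx.
pose J := I :\: [set q | (p <= q)%O].
have idJ : order_ideal J.
  apply/order_idealP => x y; rewrite !inE => /andP[px xI] yx.
  by rewrite (idIP x) // andbT; apply: contra px => /le_trans; apply.
have pJ : p \notin J by rewrite !inE lexx.
have addJ : addable J p.
  apply/addableP; split=> // q qp; rewrite !inE (idIP p) ?(ltW qp) // andbT.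
  by rewrite lt_geF.
have JI : p |: J \subset I.
  by apply/subsetP => q; rewrite !inE => /orP[/eqP->|/andP[]].
have := ideal_weight_subset k JI; rewrite ideal_weight_add // wI pk.
have := addable_weight mp idJ addJ; rewrite pk => ->.
rewrite (poset_cartan_diag mp) => sum0.
have DJ q : q \in I :\: (p |: J) = (q \in I) && (p < q)%O.
  rewrite !inE negb_or negb_and negbK lt_def.
  by have [qI|] := boolP (q \in I); rewrite ?andbT ?orbF ?andbF.
have labD q : q \in I :\: (p |: J) -> lab q != k.
  by rewrite DJ => /andP[qI pq]; apply: high.
have /(sum_cartan_eq0 labD){}sum0 :
  \sum_(q in I :\: (p |: J)) cartan k (lab q) = 0 by lia.
apply/order_idealP => x y; rewrite !inE => /andP[xp xI] yx.
rewrite (idIP x y xI yx) andbT; apply: contraTneq yx => ->.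
apply/negP => px; have {px xp} px : (p < x)%O by rewrite lt_def xp.
have [r /andP[pr rx]] := neighbour_above mp px; rewrite pk => /eqP[].
by apply: sum0; rewrite DJ pr (idIP x).
Qed.

(** The only point of this label that can be flipped in [I] is [p], and in
    [flip I p] it is again [p], so the other toggles act trivially both before
    and after [p] has had its turn. *)
Lemma foldr_toggle I p (ps : seq P) : order_ideal I -> order_ideal (flip I p) ->
  uniq ps -> (forall q, q \in ps -> lab q = lab p) ->
  foldr (@toggle d P) I ps = if p \in ps then flip I p else I.
Proof.
move=> idI idf; elim: ps => [|q ps IH] //= /andP[qps ups] labE.
have labq : lab p = lab q by rewrite labE ?mem_head.
rewrite {}IH //; last by move=> r rps; rewrite labE // inE rps orbT.
rewrite inE; have [pq|neq] /= := eqVneq p q.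
  by rewrite pq (negbTE qps) toggleE -pq idf.
case: ifP => _; rewrite toggleE; case: ifP => // idq.
  have := flip_unique idf labq _ idq; rewrite flipK => /(_ idI)/eqP.
  by rewrite (negbTE neq).
by have /eqP := flip_unique idI labq idf idq; rewrite (negbTE neq).
Qed.

Lemma toggle_labelE I k p : order_ideal I -> lab p = k ->
  order_ideal (flip I p) -> toggle_label lab k I = flip I p.
Proof.
move=> idI pk idf; rewrite /toggle_label (foldr_toggle idI idf) ?enum_uniq //.
  by rewrite mem_enum inE pk eqxx.
by move=> q; rewrite mem_enum inE pk => /eqP.
Qed.

Lemma toggle_label_id I k : order_ideal I -> wt I k = 0 ->
  toggle_label lab k I = I.
Proof.
move=> idI wI; rewrite /toggle_label.
have : forall q, q \in enum [pred p | lab p == k] -> lab q = k.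
  by move=> q; rewrite mem_enum inE => /eqP.
elim: (enum _) => //= q ps IH labE; rewrite IH => [|r rps]; last first.
  by rewrite labE // inE rps orbT.
rewrite toggleE; case: ifP => // /(flip_weight idI).
by rewrite labE ?mem_head // wI; case: ifP.
Qed.

Lemma toggle_label_ideal I k : order_ideal I -> order_ideal (toggle_label lab k I).
Proof.
move=> idI; rewrite /toggle_label; elim: (enum _) => //= q ps.
exact: toggle_ideal.
Qed.

End ToggleLabel.

(** * Minimal coset representatives *)

Section MinimalRepresentatives.
Variables (F : numFieldType) (E : vectType F) (n : nat).
Variables (root : 'I_n -> E) (pairing : 'I_n -> E -> F).
Variables (cartan : 'I_n -> 'I_n -> int).
Variables (s : 'I_n -> 'End(E)) (lambda : E) (fundamental : 'I_n -> int).
Hypothesis mw : minuscule_weight root pairing cartan s lambda fundamental.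

Local Notation word := (word_prod s).
Local Notation descending := (descending cartan fundamental).
Local Notation wt := (letter_weight cartan fundamental).
Local Notation same_coset := (same_coset s lambda).
Local Notation min_rep := (min_rep s lambda).

Lemma same_coset_lambda w w' : same_coset w w' -> w lambda = w' lambda.
Proof. by move=> [x px ->]; rewrite comp_lfunE (parabolic_fix px). Qed.

Lemma same_coset_sym w w' : same_coset w w' -> same_coset w' w.
Proof.
move=> [x px ->]; have [y py xy] := parabolic_inv mw px; exists y => //.
by rewrite -comp_lfunA xy comp_lfun1r.
Qed.

Lemma same_coset_trans w2 w1 w3 :
  same_coset w1 w2 -> same_coset w2 w3 -> same_coset w1 w3.
Proof.
move=> [x px ->] [y py ->]; exists (x \o y)%VF; first exact: parabolic_comp.
by rewrite comp_lfunA.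
Qed.

Lemma same_coset_comp u w w' :
  same_coset w w' -> same_coset (u \o w)%VF (u \o w')%VF.
Proof. by move=> [x px ->]; exists x => //; rewrite comp_lfunA. Qed.

Lemma descending_length b : descending b -> has_length s (word b) (size b).
Proof.
move=> db; split; first by exists b.
by move=> a ea; apply: (descending_size_min mw db _); rewrite ea.
Qed.

Lemma descending_min_rep b : descending b -> min_rep (word b).
Proof.
move=> db; split; first by exists b.
move=> w k k' /same_coset_lambda ew [_ kmin] [[a <- ea] _].
apply: (leq_trans (kmin b erefl)).
by apply: (descending_size_min mw db _); rewrite ea.
Qed.

(** A descending word in the same coset is at most as long as [a] by
    [word_descend], and at least as long by minimality; equality of lengths
    forces [a] itself to descend. *)
Lemma reduced_word_descending a w :
  min_rep w -> reduced_word s a w -> descending a.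
Proof.
move=> [_ wmin] [ea wa]; have [b [db szb [x px ex] dc]] := word_descend mw a.
apply: dc; apply/eqP; rewrite eqn_leq szb /=.
apply: (wmin (word b)) wa (descending_length db).
by apply: same_coset_sym; exists x; rewrite // -ea.
Qed.

Lemma weyl_reduced_word w : weyl s w -> exists a, reduced_word s a w.
Proof.
move=> [c ec]; pose has_word k := [exists t : k.-tuple 'I_n, word t == w].
have ex_word : exists k, has_word k.
  by exists (size c); apply/existsP; exists (in_tuple c); apply/eqP.
case: (ex_minnP ex_word) => k /existsP[t /eqP et] kmin.
exists t; split=> //; split; first by exists t.
move=> a ea; rewrite size_tuple; apply: kmin.
by apply/existsP; exists (in_tuple a); apply/eqP.
Qed.

(** Another minimal representative of the coset has a reduced word which is
    descending, and which leads to the same weight as [b]. *)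
Lemma left_translate_unique u w b : descending b ->
  same_coset (u \o w)%VF (word b) ->
  unique (left_translate s lambda u w) (word b).
Proof.
move=> db uwb; split; first by split=> //; apply: descending_min_rep.
move=> v [vmin uwv]; have [a va] := weyl_reduced_word vmin.1.
have da := reduced_word_descending vmin va; have [ea _] := va.
rewrite -ea; apply: (descending_unique mw db da _).1 => i; apply: (@intr_inj F).
rewrite -(letter_weightE mw db) -(letter_weightE mw da).
by rewrite ea -(same_coset_lambda uwb) -(same_coset_lambda uwv).
Qed.

(** A letter that still lowers the weight would give a longer minimal
    representative. *)
Lemma longest_letter_weight a w :
  longest_min_rep s lambda w -> reduced_word s a w -> forall i, wt a i <= 0.
Proof.
move=> [wmin wmax] wa i; have da := reduced_word_descending wmin wa.
have := letter_weight_bound mw i da.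
have [wi|wi] := eqVneq (wt a i) 1; last by lia.
have dia : descending (i :: a) by rewrite /= wi eqxx.
have := wmax _ _ _ (descending_min_rep dia) (descending_length dia) wa.2.
by rewrite /= ltnn.
Qed.

End MinimalRepresentatives.

(** * The heap of a descending word *)

Section Heap.
Variables (F : numFieldType) (E : vectType F) (n : nat).
Variables (root : 'I_n -> E) (pairing : 'I_n -> E -> F).
Variables (cartan : 'I_n -> 'I_n -> int).
Variables (s : 'I_n -> 'End(E)) (lambda : E) (fundamental : 'I_n -> int).
Hypothesis mw : minuscule_weight root pairing cartan s lambda fundamental.

Local Notation word := (word_prod s).
Local Notation descending := (descending cartan fundamental).
Local Notation wt := (letter_weight cartan fundamental).

Variable a : seq 'I_n.
Hypothesis da : descending a.

Local Notation letter := (tnth (in_tuple a)).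
Local Notation step := (heap_step s (a := a)).

Lemma step_cartan (i j : 'I_(size a)) : step i j ->
  (j < i)%N /\ cartan (letter j) (letter i) != 0.
Proof.
move=> /andP[ji /eqP ncomm]; split=> //; apply/eqP => c0; apply: ncomm.
by rewrite (refl_commute mw c0).
Qed.

Lemma cartan_step (i j : 'I_(size a)) : (j < i)%N -> letter i != letter j ->
  cartan (letter j) (letter i) != 0 -> step i j.
Proof.
move=> ji neq c0; apply/andP; split=> //; apply: contra c0 => /eqP comm.
by apply/eqP/(commute_cartan_eq0 mw); rewrite // eq_sym.
Qed.

Lemma heap_le_leq i j : heap_le s (a := a) i j -> (j <= i)%N.
Proof.
move=> /connectP[pth]; elim: pth i => /= [|k pth IH] i; first by move=> _ ->.
by move=> /andP[/step_cartan[ki _] /IH h /h]; lia.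
Qed.

Lemma heap_le_last i j : i != j -> heap_le s (a := a) i j ->
  exists k, [/\ heap_le s (a := a) i k, heap_le s (a := a) k j, k != j
    & cartan (letter j) (letter k) != 0].
Proof.
move=> neq /connectP[pth]; case/lastP: pth => [|pth k].
  by move=> _ /= ij; rewrite ij eqxx in neq.
rewrite rcons_path last_rcons => /andP[pk kj] ->.
exists (last i pth); split.
- by apply/connectP; exists pth.
- exact: connect1.
- by apply: contraTneq (step_cartan kj).1 => ->; rewrite ltnn.
- exact: (step_cartan kj).2.
Qed.

Lemma heap_le_first i j : i != j -> heap_le s (a := a) i j ->
  exists k, [/\ heap_le s (a := a) i k, heap_le s (a := a) k j, k != i
    & cartan (letter k) (letter i) != 0].
Proof.
move=> neq /connectP[[|k pth]] /=.
  by move=> _ /= ij; rewrite ij eqxx in neq.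
move=> /andP[ik pk] ->; exists k; split.
- exact: connect1.
- by apply/connectP; exists pth.
- by apply: contraTneq (step_cartan ik).1 => ->; rewrite ltnn.
- exact: (step_cartan ik).2.
Qed.

Lemma descending_drop k : descending (drop k a).
Proof.
elim: a da k => [|i b IH] //= /andP[wi db] [|k] /=; first by rewrite wi.
exact: IH.
Qed.

Lemma letter_weight_drop (j : 'I_(size a)) : wt (drop j.+1 a) (letter j) = 1.
Proof.
have ej : nth (letter j) a j = letter j by rewrite [RHS](tnth_nth (letter j)).
by have := descending_drop j; rewrite (drop_nth (letter j)) // ej => /andP[/eqP].
Qed.

Lemma sum_drop (k : nat) (G : 'I_n -> int) :
  \sum_(x <- drop k a) G x = \sum_(m < size a | (k <= m)%N) G (letter m).
Proof.
have [sz|sz] := leqP (size a) k.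
  rewrite drop_oversize // big_nil big_pred0 // => m; apply: negbTE.
  by rewrite -ltnNge (leq_trans (ltn_ord m)).
have x0 : 'I_n by case: a sz.
under [RHS]eq_bigr do rewrite (tnth_nth x0) /=.
rewrite -(big_geq_mkord _ _ predT (fun m => G (nth x0 a m))) -[in RHS](add0n k).
rewrite big_addn (big_nth x0) size_drop.
by apply: eq_bigr => i _; rewrite nth_drop addnC.
Qed.

(** For distinct letters this is a single step of the heap. Between two equal
    letters [k] the weight at [k] has to return from [-1] to [1], so some letter
    in between is adjacent to [k], and it yields a step from each of them. *)
Lemma cartan_heap_le (i j : 'I_(size a)) : (i < j)%N ->
  cartan (letter i) (letter j) != 0 -> heap_le s (a := a) j i.
Proof.
move=> ij cij; have [eij|neq] := eqVneq (letter j) (letter i); last first.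
  by apply/connect1/cartan_step.
set k := letter i in eij *.
have [m /andP[/andP[im mj] neg]] : exists m : 'I_(size a),
    (i < m <= j)%N && (cartan k (letter m) < 0).
  apply/existsP; apply: contraT => /existsPn ge0.
  have sum0 : \sum_(m < size a | (i < m <= j)%N) cartan k (letter m) = 0.
    have := letter_weight_drop i; have := letter_weight_drop j.
    rewrite eij /letter_weight -/k !sum_drop => ej.
    rewrite (bigID (fun m : 'I__ => (m <= j)%N)) /=.
    have aux (x S T : int) : x - T = 1 -> x - (S + T) = 1 -> S = 0 by lia.
    rewrite [X in _ - (_ + X)](eq_bigl (fun m : 'I__ => (j < m)%N)).
      exact: aux ej.
    by move=> m /=; rewrite -ltnNge andb_idl //; apply: ltn_trans.
  have /psumr_eq0P/(_ sum0) : forall m : 'I_(size a), (i < m <= j)%N ->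
      0 <= cartan k (letter m).
    by move=> m imj; have := ge0 m; rewrite imj /= -leNgt.
  by move=> /(_ j); rewrite ij leqnn eij (cartan_diag mw) => /(_ isT).
have km : letter m != k.
  by apply: contraTneq neg => ->; rewrite (cartan_diag mw).
have kneq : cartan k (letter m) != 0 by rewrite lt_eqF.
have {}mj : (m < j)%N.
  by rewrite ltn_neqAle mj andbT; apply: contraNneq km => /val_inj ->; rewrite eij.
apply: (connect_trans (connect1 _) (connect1 _)); last first.
  exact: cartan_step im km kneq.
apply: cartan_step mj _ _; rewrite eij; first by rewrite eq_sym.
by apply: contra kneq => /eqP /(cartan_eq0 mw) ->.
Qed.

Variables (d : Order.disp_t) (P : finPOrderType d) (lab : P -> 'I_n).
Variable f : P -> 'I_(size a).
Hypothesis f_bij : bijective f.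
Hypothesis f_le : forall p q, (p <= q)%O = heap_le s (a := a) (f p) (f q).
Hypothesis f_lab : forall p, lab p = letter (f p).
Hypothesis wt_top : forall k, wt a k <= 0.

Local Notation iwt := (ideal_weight lab cartan fundamental).

Let f_inj : injective f := bij_inj f_bij.

Lemma cartan_comparable p q :
  cartan (lab p) (lab q) != 0 -> (p <= q)%O || (q <= p)%O.
Proof.
rewrite !f_lab !f_le => cpq.
have [pq|qp|/val_inj/f_inj ->] := ltngtP (f p) (f q).
- by rewrite (cartan_heap_le pq) ?orbT.
- rewrite (cartan_heap_le qp) //.
  by apply: contra cpq => /eqP /(cartan_eq0 mw) ->.
- by rewrite -f_le lexx.
Qed.

Lemma neighbour_below_heap p q : (p < q)%O ->
  exists2 r, (p <= r < q)%O & cartan (lab r) (lab q) != 0.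
Proof.
rewrite lt_def f_le => /andP[qp pq]; have [g fK gK] := f_bij.
have [|k [pk kq neq ck]] := heap_le_last _ pq; first by rewrite inj_eq // eq_sym.
exists (g k); rewrite ?f_lab ?gK.
  by rewrite lt_def !f_le gK pk kq andbT -(inj_eq f_inj) gK eq_sym.
by apply: contra ck => /eqP /(cartan_eq0 mw) ->.
Qed.

Lemma neighbour_above_heap p q : (p < q)%O ->
  exists2 r, (p < r <= q)%O & cartan (lab r) (lab p) != 0.
Proof.
rewrite lt_def f_le => /andP[qp pq]; have [g fK gK] := f_bij.
have [|k [pk kq neq ck]] := heap_le_first _ pq; first by rewrite inj_eq // eq_sym.
exists (g k); rewrite ?f_lab ?gK //.
by rewrite lt_def !f_le gK pk kq !andbT -(inj_eq f_inj) gK.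
Qed.

Lemma letter_weight_drop_poset (k : nat) i : wt (drop k a) i =
  fundamental i - \sum_(q | (k <= f q)%N) cartan i (lab q).
Proof.
rewrite /letter_weight sum_drop (reindex f) /=; last exact: onW_bij.
by under eq_bigr do rewrite -f_lab.
Qed.

(** Compare [I] with the ideal of all positions to the right of [p] in the word
    [a], for which the value is [1] because [a] descends. A point in one but not
    in the other is incomparable to [p], hence contributes [0] to the weight at
    the label of [p]. *)
Lemma addable_weight_heap I p : order_ideal I -> addable I p ->
  iwt I (lab p) = 1.
Proof.
move=> /order_idealP idI /addableP[pI low].
have := letter_weight_drop (f p); rewrite -f_lab letter_weight_drop_poset => <-.
rewrite /ideal_weight; congr (_ - _); rewrite big_mkcond [RHS]big_mkcond /=.
apply: eq_bigr => q _; case: ifP; case: ltnP => // fpq qI; apply/eqP; last first.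
  rewrite eq_sym; apply: contraFT qI => /cartan_comparable/orP[]; last first.
    rewrite le_eqVlt => /orP[/eqP qp|/low //].
    by rewrite qp ltnn in fpq.
  by rewrite f_le => /heap_le_leq; rewrite leqNgt fpq.
apply: contraT => /cartan_comparable/orP[/(idI _ _ qI)|]; first exact/contraTT.
rewrite f_le => /heap_le_leq fqp; have /val_inj/f_inj e : f q = f p :> nat by lia.
by rewrite -e qI in pI.
Qed.

(** The last element of a linear extension is maximal, hence addable to the
    ideal of the preceding ones. *)
Lemma linear_extension_descending I xs : order_ideal I -> linear_extension I xs ->
  let b := rev [seq lab x | x <- xs] in descending b /\ wt b =1 iwt I.
Proof.
have wtE J ys : linear_extension J ys -> wt (rev [seq lab x | x <- ys]) =1 iwt J.
  move=> [uys ysJ _] i; rewrite /letter_weight /ideal_weight; congr (_ - _).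
  rewrite (perm_big _ (permEl (perm_rev _))) big_map -big_enum /=.
  apply: perm_big; apply: uniq_perm; rewrite ?enum_uniq // => x.
  by rewrite mem_enum ysJ.
move=> idI lin /=; split; last exact: wtE.
elim/last_ind: xs I idI lin => // ys p IH I idI [u memI idx].
move: u; rewrite rcons_uniq => /andP[pys uys].
have pI : p \in I by rewrite -memI mem_rcons mem_head.
have ysE : ys =i I :\ p.
  move=> x; rewrite !inE -memI mem_rcons inE.
  by have [->|] := eqVneq x p; rewrite ?(negbTE pys).
have idx_ys x : x \in ys -> index x (rcons ys p) = index x ys.
  by move=> xys; rewrite -cats1 index_cat xys.
have idx_p : index p (rcons ys p) = size ys.
  by rewrite -cats1 index_cat (negbTE pys) /= eqxx addn0.
have lin : linear_extension (I :\ p) ys.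
  split=> // x y; rewrite -!ysE => xys yys xy.
  rewrite -!idx_ys //; apply: idx => //; rewrite -memI mem_rcons inE.
    by rewrite xys orbT.
  by rewrite yys orbT.
have idI' : order_ideal (I :\ p).
  apply/order_idealP => x y; rewrite -!ysE => xys yx.
  have xI : x \in I by rewrite -memI mem_rcons inE xys orbT.
  have yI := order_idealP _ idI _ _ xI yx.
  rewrite ysE !inE yI andbT; apply/eqP => yp.
  have := idx y x yI xI yx; rewrite yp idx_p idx_ys // leqNgt index_mem.
  by rewrite xys.
rewrite map_rcons rev_rcons /= (IH _ idI' lin) andbT (wtE _ _ lin).
by rewrite (addable_weight_heap idI') ?addable_setD1.
Qed.

Variable phi : {set P} -> 'End(E).
Hypothesis phiP : heap_map lab s phi.

Lemma heap_minuscule_poset : minuscule_poset lab cartan fundamental.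
Proof.
split.
- exact: cartan_diag mw.
- exact: cartan_le0 mw.
- exact: cartan_eq0 mw.
- exact: fundamental_ge0 mw.
- by move=> p q pq; apply: cartan_comparable; rewrite pq (cartan_diag mw).
- exact: neighbour_below_heap.
- exact: neighbour_above_heap.
- exact: addable_weight_heap.
- move=> I k idI; have [xs lin _] := phiP idI.
  have [db <-] := linear_extension_descending idI lin.
  exact: (letter_weight_bound mw k db).
- move=> k; have := letter_weight_drop_poset 0 k; rewrite drop0.
  rewrite /ideal_weight => e; apply: le_trans (wt_top k); rewrite e.
  by rewrite (eq_bigl predT) // => q; rewrite inE.
Qed.

Lemma heap_map_descending I : order_ideal I -> exists b,
  [/\ descending b, wt b =1 iwt I & phi I = word b].
Proof.
move=> idI; have [xs lin ->] := phiP idI.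
by have [db wtb] := linear_extension_descending idI lin; eexists; split; eauto.
Qed.

(** According to the weight of [I] at [k], the toggles add one point, change
    nothing, or remove one point, while [s k] lowers, fixes or raises the weight
    of [phi I]. In the outer cases the two sides even agree as group elements, by
    uniqueness of descending words. *)
Lemma toggle_label_coset I k : order_ideal I ->
  same_coset s lambda (s k \o phi I)%VF (phi (toggle_label lab k I)).
Proof.
move=> idI; have mp := heap_minuscule_poset.
have [b [db wtb ->]] := heap_map_descending idI.
have := ideal_weight_bound mp k idI => bd.
have [w1|w1] := eqVneq (iwt I k) 1.
  have [p pk idf] := flip_exists_add mp idI w1.
  rewrite (toggle_labelE mp idI pk idf).
  have pI : p \notin I.
    by apply/negP => pI; have := flip_weight mp idI idf; rewrite pI pk w1.
  have [b' [db' wtb' ->]] := heap_map_descending idf.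
  exists \1%VF; rewrite ?comp_lfun1r; first exact: parabolic1.
  have dkb : descending (k :: b) by rewrite /= wtb w1 eqxx.
  rewrite -[RHS](descending_unique mw db' dkb _).1 // => i.
  by rewrite wtb' letter_weight_cons wtb flip_notin // ideal_weight_add // pk.
have [w0|w0] := eqVneq (iwt I k) 0.
  rewrite (toggle_label_id mp idI w0).
  have [b' [db' wtb' ->]] := heap_map_descending idI.
  rewrite (descending_unique mw db' db _).1 => [|i]; last by rewrite wtb wtb'.
  have [|x px ex] := fixed_letter mw db (i := k); first by rewrite wtb.
  by apply: (same_coset_sym mw); exists x.
have wN1 : iwt I k = -1 by lia.
have [p pk idf] := flip_exists_del mp idI wN1.
rewrite (toggle_labelE mp idI pk idf).
have pI : p \in I.
  apply/negPn/negP => /negbTE pI; have := flip_weight mp idI idf.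
  by rewrite pI pk wN1.
have [b' [db' wtb' ->]] := heap_map_descending idf.
have wtb'E i : wt b' i = iwt I i + cartan i k.
  by rewrite wtb' flip_in // ideal_weight_del // pk.
have dkb : descending (k :: b').
  by rewrite /= db' wtb'E wN1 (cartan_diag mw).
exists \1%VF; rewrite ?comp_lfun1r; first exact: parabolic1.
rewrite (descending_unique mw db dkb _).1 ?(reflK mw) // => i.
by rewrite wtb letter_weight_cons wtb'E addrK.
Qed.

Lemma toggle_word_coset I ks : order_ideal I ->
  order_ideal (toggle_word lab ks I) /\
  same_coset s lambda (word ks \o phi I)%VF (phi (toggle_word lab ks I)).
Proof.
move=> idI; elim: ks => [|k ks [idt IH]] /=.
  split=> //; exists \1%VF; rewrite ?comp_lfun1r ?comp_lfun1l //.
  exact: parabolic1.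
split; first exact: toggle_label_ideal.
apply: same_coset_trans (toggle_label_coset k idt).
by rewrite -comp_lfunA; apply: same_coset_comp.
Qed.

Lemma toggle_word_left_translate I ks : order_ideal I ->
  unique (left_translate s lambda (word ks) (phi I)) (phi (toggle_word lab ks I)).
Proof.
move=> idI; have [idt cos] := toggle_word_coset ks idI.
have [b [db _ eb]] := heap_map_descending idt.
by move: cos; rewrite eb => cos; apply: (left_translate_unique mw db cos).
Qed.

End Heap.

(** * Strings of weights *)

(** Nonzero vectors would make all [c k] roots of one characteristic
    polynomial. *)
Lemma eigenvector_eq0 (F : fieldType) (M : vectType F) (T : {linear M -> M})
    (v : nat -> M) (c : nat -> F) : injective c ->
  (forall k, T (v k) = c k *: v k) -> exists k, v k == 0.
Proof.
move=> c_inj Tv; pose m := dim M.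
have [/existsP[k vk]|/existsPn nz] := boolP [exists k : 'I_m.+1, v k == 0].
  by exists k.
pose A := lin1_mx (v2r \o T \o r2v).
have rootA (k : 'I_m.+1) : root (char_poly A) (c k).
  rewrite -eigenvalue_root_char; apply/eigenvalueP; exists (v2r (v k)).
    by rewrite mul_rV_lin1 /= v2rK Tv linearZ.
  by rewrite -(linear0 v2r) (inj_eq (can_inj v2rK)); apply: nz.
have := @max_poly_roots _ (char_poly A) [seq c (val k) | k : 'I_m.+1].
rewrite size_map size_enum_ord size_char_poly ltnn => h; exfalso.
apply/notF/h; first by rewrite -size_poly_eq0 size_char_poly.
  by apply/allP => x /mapP[k _ ->]; apply: rootA.
by rewrite map_inj_uniq ?enum_uniq // => x y /c_inj /val_inj.
Qed.

Lemma dual_lin (F : fieldType) (g : vectType F) (h : {vspace g})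
    (mu al : dual h) (c : F) (t : subvs_of h) :
  (mu + c *: al) t = mu t + c * al t :> F.
Proof. by rewrite add_lfunE scale_lfunE. Qed.

(** The action is kept abstract so that the same strings serve both the adjoint
    action and the given representation. *)
Section WeightStrings.
Variables (F : numFieldType) (g : vectType F) (br : g -> g -> g).
Hypothesis br_lie : lie_bracket br.
Variables (h : {vspace g}) (M : vectType F) (act : g -> M -> M).
Hypothesis act_linl : forall v, linear (act^~ v).
Hypothesis act_linr : forall x, linear (act x).
Hypothesis act_br : forall x y v,
  act (br x y) v = act x (act y v) - act y (act x v).

Local Notation weight := (@weight F g h M act).
Local Notation weight_vector := (@weight_vector F g h).

Lemma act0r x : act x 0 = 0.
Proof.
have := act_linr x (-1) 0 0; rewrite !scaleN1r !oppr0 addr0 => ->.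
by rewrite addNr.
Qed.

Lemma act0l v : act 0 v = 0.
Proof.
have := act_linl v (-1) 0 0; rewrite !scaleN1r !oppr0 addr0 => ->.
by rewrite addNr.
Qed.

Lemma actZr x c v : act x (c *: v) = c *: act x v.
Proof. by have := act_linr x c v 0; rewrite act0r !addr0. Qed.

Lemma actZl x c v : act (c *: x) v = c *: act x v.
Proof. by have := act_linl v c x 0; rewrite !addr0 act0l addr0. Qed.

Lemma actNl x v : act (- x) v = - act x v.
Proof. by rewrite -scaleN1r actZl scaleN1r. Qed.

Lemma act_weight_vector al x mu v : weight_vector br al x ->
  weight_vector act mu v -> weight_vector act (mu + al) (act x v).
Proof.
move=> xal vmu t; have := act_br (vsval t) x v; rewrite xal vmu actZl actZr.
move=> /eqP; rewrite eq_sym subr_eq => /eqP ->.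
by rewrite -scalerDl add_lfunE addrC.
Qed.

Lemma iter_weight_vector al x mu v k : weight_vector br al x ->
  weight_vector act mu v ->
  weight_vector act (mu + k%:R *: al) (iter k (act x) v).
Proof.
move=> xal vmu; elim: k => [|k IH] /=; first by rewrite scale0r addr0.
by rewrite -natr1 scalerDl scale1r addrA; apply: act_weight_vector.
Qed.

Lemma iter_act_eq0 (al : dual h) x mu v (t : subvs_of h) : al t != 0 ->
  weight_vector br al x -> weight_vector act mu v ->
  exists k, iter k (act x) v == 0.
Proof.
move=> alt0 xal vmu.
pose T : {linear M -> M} := HB.pack (act (vsval t))
  (GRing.isLinear.Build F M M *:%R (act (vsval t)) (act_linr (vsval t))).
apply: (@eigenvector_eq0 _ _ T _ (fun k => mu t + k%:R * al t)) => [i j|k].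
  by move=> /addrI /(mulIf alt0) /eqP; rewrite eqr_nat => /eqP.
by rewrite /= (iter_weight_vector k xal vmu) dual_lin.
Qed.

Lemma iter_last (x : g) v : v != 0 -> (exists k, iter k (act x) v == 0) ->
  exists p, iter p (act x) v != 0 /\ iter p.+1 (act x) v = 0.
Proof.
move=> v0 ex; case: (ex_minnP ex) => -[|p] ep pmin; first by rewrite ep in v0.
exists p; split; last exact: eqP ep; by apply/negP => /pmin; rewrite ltnn.
Qed.

Section Sl2.
Variables (t : subvs_of h) (al : dual h) (e f : g).
Hypotheses (al_t : al t = 2) (e_al : weight_vector br al e).
Hypotheses (f_al : weight_vector br (- al) f) (t_ef : vsval t = br e f).

Lemma raise_lower nu v k : weight_vector act nu v -> act e v = 0 ->
  act e (iter k.+1 (act f) v) =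
  ((k.+1)%:R * (nu t - k%:R)) *: iter k (act f) v.
Proof.
move=> vnu ev0; elim: k => [|k IH].
  have := act_br e f v; rewrite /= -t_ef vnu ev0 act0r subr0 => <-.
  by rewrite mul1r subr0.
have := act_br e f (iter k.+1 (act f) v); rewrite -t_ef IH actZr -iterS.
rewrite (iter_weight_vector k.+1 f_al vnu) dual_lin opp_lfunE al_t.
move=> /eqP; rewrite eq_sym subr_eq => /eqP; rewrite [iter k.+2 _ _]iterS => ->.
rewrite -scalerDl; congr (_ *: _); rewrite -[k.+2%:R]natr1 -[k.+1%:R]natr1.
by ring.
Qed.

(** Raise a weight vector [p] times by [e] until the next step gives [0], then
    lower the result [q] times by [f]. By [raise_lower] the end of the second
    chain forces the top weight to take the value [q] on the coroot. *)
Lemma weight_string mu : weight mu -> exists p q : nat,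
  mu t = q%:R - (2 * p)%:R /\
  forall k, (k <= q)%N -> weight (mu + (p%:R - k%:R) *: al).
Proof.
move=> [v v0 vmu].
have al0 : al t != 0 by rewrite al_t pnatr_eq0.
have al0' : (- al) t != 0 by rewrite opp_lfunE oppr_eq0.
have [p [vp0 vp1]] := iter_last v0 (iter_act_eq0 al0 e_al vmu).
have vp := iter_weight_vector p e_al vmu.
have [q [vq0 vq1]] := iter_last vp0 (iter_act_eq0 al0' f_al vp).
exists p, q; split.
  have := raise_lower q vp vp1; rewrite vq1 act0r => /esym/eqP.
  rewrite scaler_eq0 (negbTE vq0) orbF mulf_eq0 pnatr_eq0 /= subr_eq0.
  rewrite dual_lin al_t => /eqP <-.
  by rewrite natrM; ring.
move=> k kq; exists (iter k (act f) (iter p (act e) v)).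
  apply: contraNneq vq0 => vk0; rewrite -(subnK kq) iterD vk0.
  by elim: (q - k)%N => //= i /eqP ->; rewrite act0r.
have := iter_weight_vector k f_al vp.
by rewrite scalerN -addrA -scalerBl.
Qed.

End Sl2.

Lemma lie_bracket_anti x y : br x y = - br y x.
Proof.
case: br_lie => linr linl alt _.
have Dr u v w : br u (v + w) = br u v + br u w.
  by have := linr u 1 v w; rewrite !scale1r.
have Dl u v w : br (v + w) u = br v u + br w u.
  by have := linl u 1 v w; rewrite !scale1r.
have := alt (x + y); rewrite Dr !Dl !alt add0r addr0 => /eqP.
by rewrite addrC addr_eq0 => /eqP.
Qed.

(** Reflection reverses the string. The string built by raising first contains
    the reflected weight only if [p <= q]; in the other case [mu] is negative on
    the coroot, and the string of the opposite triple [(f, e, - t)] is used. *)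
Lemma weight_reflection (al : dual h) (t : subvs_of h) mu :
  is_coroot br al t -> weight mu ->
  exists z : int, [/\ mu t = z%:~R, weight (mu - z%:~R *: al) &
    1 <= z -> weight (mu - al)].
Proof.
move=> [al_t [e [f [e_al f_al t_ef]]]] wmu.
have [p [q [mut str]]] := weight_string al_t e_al f_al t_ef wmu.
have mutZ : mu t = (q%:Z - (2 * p)%:Z)%:~R by rewrite mut rmorphB.
exists (q%:Z - (2 * p)%:Z); split=> // [|z1]; last first.
  have := str p.+1; rewrite -[p.+1%:R]natr1 opprD addNKr scaleN1r; apply.
  by lia.
rewrite -scaleNr -rmorphN; have [le_pq|lt_qp] := leqP p q.
  have := str (q - p)%N (leq_subr _ _); congr weight.
  congr (_ + _ *: _); rewrite natrB // PoszM; ring.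
have t_fe : vsval (- t) = br f e.
  by rewrite linearN /= t_ef lie_bracket_anti opprK.
have al_t' : (- al) (- t) = 2 by rewrite opp_lfunE linearN opprK.
have e_al' : weight_vector br (- (- al)) e by rewrite opprK.
have [p' [q' [mut' str']]] := weight_string al_t' f_al e_al' t_fe wmu.
have mut2 : mu (- t) = - mu t by rewrite linearN.
have e1 : (q'%:Z - (2 * p')%:Z) = - (q%:Z - (2 * p)%:Z).
  by apply: (@intr_inj F); rewrite mulrNz -mutZ -mut2 mut' rmorphB.
have le_pq' : (p' <= q')%N by lia.
have := str' (q' - p')%N (leq_subr _ _); congr weight.
rewrite scalerN -scaleNr; congr (_ + _ *: _); rewrite -e1 natrB // PoszM; ring.
Qed.

End WeightStrings.

(** * From a minuscule representation to its orbit of weights *)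

Section MinusculeRepresentation.
Variables (F : numFieldType) (g : vectType F) (br : g -> g -> g).
Hypothesis br_lie : lie_bracket br.
Variables (h : {vspace g}) (n : nat) (alpha : 'I_n -> dual h).
Hypothesis alpha_simple : simple_system br alpha.
Variable coroot : 'I_n -> subvs_of h.
Hypothesis corootP : forall i, is_coroot br (alpha i) (coroot i).
Variable s : 'I_n -> 'End(dual h).
Hypothesis sE : forall i, s i = reflection (alpha i) (coroot i).

Local Notation is_root := (is_root br).
Local Notation word := (word_prod s).
Local Notation pair i mu := ((mu : dual h) (coroot i) : F).
Local Notation coef := (coord [tuple alpha i | i < n]).

Lemma reflectionE i mu : s i mu = mu - pair i mu *: alpha i.
Proof. by rewrite sE lfunE. Qed.

Lemma coef_alpha i k : coef k (alpha i) = (i == k)%:R.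
Proof.
have [_ fr _] := alpha_simple; rewrite -(coord_free i k fr).
by rewrite -tnth_nth tnth_mktuple.
Qed.

Lemma coroot_alpha i : pair i (alpha i) = 2.
Proof. by have [] := corootP i. Qed.

Lemma alpha_free i j a b : i != j -> a *: alpha i = b *: alpha j -> a = 0.
Proof.
move=> ij /(congr1 (coef i)); rewrite !linearZ /= !coef_alpha eqxx mulr1.
by rewrite eq_sym (negbTE ij) mulr0.
Qed.

Lemma reflection_eq0 i mu : s i mu = 0 -> mu = 0.
Proof.
rewrite reflectionE => /eqP; rewrite subr_eq0 => /eqP mu_al.
have /eqP : pair i mu = pair i mu * 2.
  by rewrite {1}mu_al scale_lfunE coroot_alpha.
rewrite -subr_eq0 (_ : _ - _ = - pair i mu); last by ring.
by rewrite oppr_eq0 => /eqP mu0; rewrite mu_al mu0 scale0r.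
Qed.

Lemma weyl_eq0 w mu : weyl s w -> w mu = 0 -> mu = 0.
Proof.
move=> [a <-]; elim: a => [|i a IH] /=; first by rewrite id_lfunE.
by rewrite comp_lfunE => /reflection_eq0.
Qed.

Lemma adjoint_br x y v : br (br x y) v = br x (br y v) - br y (br x v).
Proof.
have [linr linl alt jacobi] := br_lie; have anti := lie_bracket_anti br_lie.
have := jacobi x y v; rewrite (anti v x) (anti v (br x y)) => /eqP.
have N u w : br u (- w) = - br u w.
  by rewrite (anti u (- w)) (actNl linl) opprK; apply: anti.
by rewrite N subr_eq0 => /eqP <-.
Qed.

Lemma root_reflection i b : is_root b ->
  exists2 z : int, pair i b = z%:~R & is_root (s i b).
Proof.
have [linr linl _ _] := br_lie => -[b0 wb].
have [z [bz wz _]] :=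
  weight_reflection br_lie linl linr adjoint_br (corootP i) wb.
exists z => //; split; last by rewrite reflectionE bz.
by apply: contraNneq b0 => /reflection_eq0 ->.
Qed.

Lemma root_coef b : is_root b ->
  (forall k, 0 <= coef k b) \/ (forall k, coef k b <= 0).
Proof.
have ge0 (m : 'I_n -> nat) k : 0 <= coef k (\sum_i alpha i *+ m i).
  rewrite linear_sum sumr_ge0 // => i _.
  by rewrite raddfMn /= mulrn_wge0 // coef_alpha ler0n.
have [_ _ sgn] := alpha_simple => /sgn[m [->|->]]; [left|right] => k //.
by rewrite linearN oppr_le0; apply: ge0.
Qed.

Lemma cartan_exists : exists cartan : 'I_n -> 'I_n -> int,
  forall i j, pair i (alpha j) = (cartan i j)%:~R.
Proof.
have [rt _ _] := alpha_simple.
apply: (@fin_all_exists _ _ (fun i (c : 'I_n -> int) =>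
  forall j, pair i (alpha j) = (c j)%:~R)) => i.
apply: (@fin_all_exists _ _ (fun j z => pair i (alpha j) = z%:~R)) => j.
by have [z] := root_reflection i (rt j); exists z.
Qed.

Section Cartan.
Variable cartan : 'I_n -> 'I_n -> int.
Hypothesis cartanE : forall i j, pair i (alpha j) = (cartan i j)%:~R.

Lemma cartan_two i : cartan i i = 2.
Proof. by apply: (@intr_inj F); rewrite -cartanE coroot_alpha. Qed.

(** The reflection of a simple root [alpha j] is a root with coefficient [1] at
    [j] and [- cartan i j] at [i], and these have the same sign. *)
Lemma cartan_nonpos i j : i != j -> cartan i j <= 0.
Proof.
move=> ij; have [rt _ _] := alpha_simple.
have [_ _ /root_coef] := root_reflection i (rt j).
rewrite reflectionE cartanE => -[/(_ i)|/(_ j)];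
  rewrite linearB linearZ /= !coef_alpha eqxx.
  by rewrite eq_sym (negbTE ij) mulr1 sub0r oppr_ge0 lerz0.
by rewrite (negbTE ij) mulr0 subr0 ler10.
Qed.

(** With [cartan i j = 0], reflecting [alpha i] by [j] and then by [i] gives the
    root [- alpha i - cartan j i *: alpha j]. *)
Lemma cartan_zero i j : cartan i j = 0 -> cartan j i = 0.
Proof.
have [<-//|ij] := eqVneq i j => cij; have [rt _ _] := alpha_simple.
apply/eqP; rewrite eq_le cartan_nonpos 1?eq_sym //=.
have [_ _ /(root_reflection i)[_ _ /root_coef]] := root_reflection j (rt i).
rewrite !reflectionE add_lfunE opp_lfunE scale_lfunE !cartanE cij scaler0 subr0.
rewrite cartan_two => -[/(_ i)|/(_ j)];
  rewrite !linearB !linearZ /= !coef_alpha eqxx.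
  rewrite eq_sym (negbTE ij) mulr0 subr0 mulr1 subr_ge0.
  by rewrite (ler_nat _ 2 1).
by rewrite (negbTE ij) mulr0 mulr1 sub0r subr0 oppr_le0 ler0z.
Qed.
End Cartan.

Variables (V : vectType F) (rho : {linear g -> 'End(V)}).
Hypothesis rho_rep : lie_representation br rho.
Variable LambdaV : dual h -> Prop.
Hypothesis LambdaVE : forall mu, LambdaV mu <-> weight (fun x v => rho x v) mu.
Hypothesis V_minuscule : forall mu nu, LambdaV mu -> LambdaV nu ->
  exists2 w, weyl s w & w mu = nu.
Variable lambda : dual h.
Hypothesis lambda_weight : LambdaV lambda.
Hypothesis lambda_highest :
  forall mu, LambdaV mu -> root_le alpha coroot mu lambda.

Lemma LambdaV_reflection i mu : LambdaV mu -> exists z : int,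
  [/\ pair i mu = z%:~R, LambdaV (s i mu) & 1 <= z -> LambdaV (mu - alpha i)].
Proof.
move=> /LambdaVE wmu.
have linl v : linear (fun x => rho x v).
  by move=> c x y; rewrite linearP add_lfunE scale_lfunE.
have linr x : linear (rho x : V -> V) by move=> c u v; rewrite linearP.
have [z [muz wz wal]] :=
  weight_reflection br_lie linl linr rho_rep (corootP i) wmu.
exists z; split=> // [|z1]; apply/LambdaVE; last exact: wal.
by rewrite reflectionE muz.
Qed.

Lemma LambdaV_weyl w mu : weyl s w -> LambdaV mu -> LambdaV (w mu).
Proof.
move=> [a <-] mL; elim: a => [|i a IH] /=; first by rewrite id_lfunE.
by rewrite comp_lfunE; have [z []] := LambdaV_reflection i IH.
Qed.

Lemma below_highest mu : LambdaV mu ->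
  exists m : 'I_n -> nat, lambda - mu = \sum_i alpha i *+ m i.
Proof.
move=> /lambda_highest.
elim=> {mu} [mu om [_ _ [i ->]]|mu|x y z _ [m1 e1] _ [m2 e2]].
- exists (fun k => (k == i : nat)); rewrite (bigD1 i) //= eqxx big1 ?addr0 //.
  by move=> k /negbTE ->.
- by exists (fun _ => 0%N); rewrite subrr big1.
- exists (fun k => (m1 k + m2 k)%N); under eq_bigr do rewrite mulrnDr.
  by rewrite big_split /= -e1 -e2 addrC addrA subrK.
Qed.

Lemma below_highest_coef mu k : LambdaV mu -> 0 <= coef k (lambda - mu).
Proof.
move=> /below_highest[m ->]; rewrite linear_sum sumr_ge0 // => i _.
by rewrite raddfMn /= mulrn_wge0 // coef_alpha ler0n.
Qed.

Lemma coef_eq0 mu : LambdaV mu -> (forall k, coef k (lambda - mu) = 0) ->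
  mu = lambda.
Proof.
move=> /below_highest[m e] c0; apply/esym/eqP; rewrite -subr_eq0 e big1 // => i _.
suff -> : m i = 0%N by [].
have := c0 i; rewrite e linear_sum (bigD1 i) //= big1 => [|k /negbTE ki].
  by rewrite raddfMn /= coef_alpha eqxx addr0 => /eqP; rewrite pnatr_eq0 => /eqP.
by rewrite raddfMn /= coef_alpha ki mul0rn.
Qed.

(** If [mu] took a value [z >= 2] on the coroot, the weight [mu - alpha i] would
    lie strictly between [mu] and its reflection. A Weyl group element carrying
    it to [lambda] would put [lambda] strictly between two weights, although
    [lambda] is an extreme point of the set of weights, being above all of
    them. *)
Lemma LambdaV_pairing_le1 i mu z : LambdaV mu -> pair i mu = z%:~R -> z <= 1.
Proof.
move=> muL muz; have [z' [muz' smuL nuL]] := LambdaV_reflection i muL.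
have zz' : z' = z by apply: (@intr_inj F); rewrite -muz.
rewrite leNgt; apply/negP => z2.
have {}nuL : LambdaV (mu - alpha i) by apply: nuL; lia.
have [w wW wnu] := V_minuscule nuL lambda_weight.
have al0 : alpha i != 0 by have [/(_ i)[]] := alpha_simple.
have wal : w (alpha i) = w mu - lambda by rewrite -wnu linearB opprB addrC subrK.
suff wmu : w mu = lambda.
  by case/eqP: al0; apply: (weyl_eq0 wW); rewrite wal wmu subrr.
apply: coef_eq0 (LambdaV_weyl wW muL) _ => k.
have := below_highest_coef k (LambdaV_weyl wW smuL).
have -> : lambda - w (s i mu) = (1 - z%:~R) *: (lambda - w mu).
  rewrite reflectionE linearB linearZ /= wal muz scalerBl scale1r -scalerN.
  by rewrite opprB opprB [_ *: _ - _]addrC addrA.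
rewrite linearZ /= nmulr_rge0 => [le0|]; last first.
  by rewrite subr_lt0 -(ltr_int F) in z2 *.
by apply/eqP; rewrite eq_le le0 below_highest_coef //; apply: LambdaV_weyl.
Qed.

Lemma LambdaV_pairing i mu : LambdaV mu ->
  exists2 z : int, -1 <= z <= 1 & pair i mu = z%:~R.
Proof.
move=> muL; have [z [muz smuL _]] := LambdaV_reflection i muL; exists z => //.
rewrite (LambdaV_pairing_le1 muL muz) andbT lerNl.
apply: (LambdaV_pairing_le1 smuL (i := i)).
by rewrite reflectionE -scaleNr dual_lin coroot_alpha muz mulrNz; ring.
Qed.

(** Otherwise the reflection of [lambda] would be above [lambda]. *)
Lemma highest_dominant i z : pair i lambda = z%:~R -> 0 <= z.
Proof.
move=> lz; have [_ [_ smuL _]] := LambdaV_reflection i lambda_weight.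
have := below_highest_coef i smuL.
by rewrite reflectionE opprB addrC subrK linearZ /= coef_alpha eqxx mulr1 lz ler0z.
Qed.

Lemma minuscule_representation_weight : exists cartan fundamental,
  minuscule_weight alpha (fun i mu => pair i mu) cartan s lambda fundamental.
Proof.
have [cartan cartanE] := cartan_exists.
have [p pE] : exists p : 'I_n -> int, forall i, pair i lambda = (p i)%:~R.
  apply: (@fin_all_exists _ _ (fun i z => pair i lambda = z%:~R)) => i.
  by have [z _] := LambdaV_pairing i lambda_weight; exists z.
exists cartan, p; split=> //.
- by move=> i u c v; apply: dual_lin.
- exact: reflectionE.
- exact: alpha_free.
- exact: cartan_two.
- exact: cartan_nonpos.
- exact: cartan_zero.
- by move=> i; apply: highest_dominant (pE i).
- by move=> i a; apply/LambdaV_pairing/LambdaV_weyl => //; exists a.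
Qed.

End MinusculeRepresentation.

(** * The commutative diagram *)

Theorem theorem1p4 (R : realType)
    (g : vectType R[i]) (br : g -> g -> g)
    (br_lie : lie_bracket br) (br_simple : lie_simple br)
    (h : {vspace g}) (h_cartan : cartan_subalgebra br h)
    (n : nat) (alpha : 'I_n -> dual h) (alpha_simple : simple_system br alpha)
    (coroot : 'I_n -> subvs_of h)
    (corootP : forall i, is_coroot br (alpha i) (coroot i))
    (s : 'I_n -> 'End(dual h))
    (sE : forall i, s i = reflection (alpha i) (coroot i))
    (V : vectType R[i]) (rho : {linear g -> 'End(V)})
    (rho_rep : lie_representation br rho)
    (rho_irr : lie_irreducible rho) (rho_nontriv : lie_nontrivial rho)
    (LambdaV : dual h -> Prop)
    (LambdaVE : forall mu, LambdaV mu <-> weight (fun x v => rho x v) mu)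
    (V_minuscule : forall mu nu, LambdaV mu -> LambdaV nu ->
       exists2 w, weyl s w & w mu = nu)
    (lambda : dual h) (lambda_weight : LambdaV lambda)
    (lambda_highest : forall mu, LambdaV mu -> root_le alpha coroot mu lambda)
    (d : Order.disp_t) (P : finPOrderType d)
    (P_minuscule : join_irreducible_poset LambdaV (root_le alpha coroot) P)
    (w0J : 'End(dual h)) (w0JP : longest_min_rep s lambda w0J)
    (lab : P -> 'I_n) (labP : heap_labeling s w0J lab)
    (phi : {set P} -> 'End(dual h)) (phiP : heap_map lab s phi)
    (ord : n.-tuple 'I_n) (ord_uniq : uniq ord)
    (I : {set P}) (I_ideal : order_ideal I) :
  unique (left_translate s lambda (word_prod s ord) (phi I))
         (phi (toggle_word lab ord I)).
Proof.
have [cartan [p mw]] := minuscule_representation_weight br_lie alpha_simple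
  corootP sE rho_rep LambdaVE V_minuscule lambda_weight lambda_highest.
have [a [wa [f [f_bij f_le f_lab]]]] := labP.
have da := reduced_word_descending mw w0JP.1 wa.
have top := longest_letter_weight mw w0JP wa.
exact: (toggle_word_left_translate mw da f_bij f_le f_lab top phiP).
Qed.
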